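(* The category $\mathbf{Skb}$ of skew braces is not action accessible. That is, there exist a skew brace $X$ and an object of $\mathrm{Split}_{\mathbf{Skb}}(X)$ (a split extension of skew braces with kernel $X$) which is not accessible, i.e. which admits no morphism in $\mathrm{Split}_{\mathbf{Skb}}(X)$ into a faithful object of $\mathrm{Split}_{\mathbf{Skb}}(X)$.
   Context: A skew (left) brace is a set $B$ with two group operations $+$ and $\circ$ (neither assumed commutative) such that $a\circ(b+c)=a\circ b-a+a\circ c$ for all $a,b,c\in B$. The identities of $(B,+)$ and $(B,\circ)$ coincide and are denoted $0$. $\mathbf{Skb}$ is the category whose objects are skew braces and whose morphisms are maps preserving both operations; it is a semi-abelian variety with zero object $\{0\}$. Let $\mathcal{C}$ be a semi-abelian category and $X$ an object of $\mathcal{C}$. A split extension with kernel $X$ is a diagram $X\xrightarrow{\mu}E\xrightarrow{p}A$ in $\mathcal{C}$ together with a morphism $s:A\to E$ such that $\mu$ is a kernel of $p$ and $p s=\mathrm{id}_A$; it is denoted $(A,E,p,s,\mu)$. (In $\mathbf{Skb}$: $\mu$ is injective with image $\{e\in E: p(e)=0\}$.) The category $\mathrm{Split}_{\mathcal{C}}(X)$ has these split extensions (with arbitrary $A$ and $E$) as objects; a morphism $(A,E,p,s,\mu)\to(A',E',p',s',\mu')$ is a pair of morphisms $f:E\to E'$, $g:A\to A'$ in $\mathcal{C}$ with $f\mu=\mu'$, $p'f=gp$ and $fs=s'g$. An object $\Sigma$ of $\mathrm{Split}_{\mathcal{C}}(X)$ is faithful if every object of $\mathrm{Split}_{\mathcal{C}}(X)$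 admits at most one morphism into $\Sigma$. An object is accessible if it admits a morphism into some faithful object. The category $\mathcal{C}$ is action accessible if, for every object $X$ of $\mathcal{C}$, every object of $\mathrm{Split}_{\mathcal{C}}(X)$ is accessible. *)

(* Defs.v *)
From mathcomp Require Import ssreflect ssrfun ssrbool.

Set Implicit Arguments.
Unset Strict Implicit.
Unset Printing Implicit Defensive.

Declare Scope skb_scope.
Delimit Scope skb_scope with skb.
Local Open Scope skb_scope.

Record is_group (T : Type) (op : T -> T -> T) (e : T) (inv : T -> T) : Prop :=
  IsGroup {
    groupA : associative op;
    group1l : left_id e op;
    group1r : right_id e op;
    groupVl : left_inverse e inv op;
    groupVr : right_inverse e inv op
  }.

(* The carrier is an arbitrary type and equality is Leibniz equality.  The
   groupType of MathComp is not used: it would demand a choice structure on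
   the carrier, and it provides one multiplicative law per type, whereas the
   two laws here are both possibly noncommutative. *)
Record skewBrace : Type := SkewBrace {
  skb_sort :> Type;
  skb_add : skb_sort -> skb_sort -> skb_sort;
  skb_zero : skb_sort;
  skb_opp : skb_sort -> skb_sort;
  skb_circ : skb_sort -> skb_sort -> skb_sort;
  skb_one : skb_sort;
  skb_inv : skb_sort -> skb_sort;
  skb_add_group : is_group skb_add skb_zero skb_opp;
  skb_circ_group : is_group skb_circ skb_one skb_inv;
  skb_brace : forall a b c : skb_sort,
    skb_circ a (skb_add b c)
      = skb_add (skb_add (skb_circ a b) (skb_opp a)) (skb_circ a c)
}.

Arguments skb_zero {s}.
Arguments skb_one {s}.

Notation "0" := skb_zero : skb_scope.
Notation "x + y" := (skb_add x y) : skb_scope.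
Notation "- x" := (skb_opp x) : skb_scope.
Notation "x - y" := (skb_add x (skb_opp y)) : skb_scope.
Notation "x \oc y" := (skb_circ x y) (at level 40, left associativity) :
  skb_scope.

Lemma skb_one_zero (B : skewBrace) : skb_one = 0 :> B.
Proof.
have [aA a0l a0r aNl aNr] := skb_add_group B.
have [_ c1l _ _ _] := skb_circ_group B.
have := @skb_brace B skb_one 0 0.
rewrite a0l !c1l a0l a0r => opp1.
by rewrite -[LHS]a0l {1}opp1 aNl.
Qed.

Record skbHom (B C : skewBrace) : Type := SkbHom {
  skb_fun :> B -> C;
  skb_homD : forall x y : B, skb_fun (x + y) = skb_fun x + skb_fun y;
  skb_homC : forall x y : B, skb_fun (x \oc y) = skb_fun x \oc skb_fun y
}.

(* Objects of Split_Skb(X).  split_mu_inj and split_mu_ker say that mu is a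
   kernel of p in Skb. *)
Record splitExt (X : skewBrace) : Type := SplitExt {
  split_base : skewBrace;
  split_total : skewBrace;
  split_p : skbHom split_total split_base;
  split_s : skbHom split_base split_total;
  split_mu : skbHom X split_total;
  split_mu_inj : injective split_mu;
  split_mu_ker : forall e : split_total,
    split_p e = 0 <-> exists x : X, split_mu x = e;
  split_ps : forall a : split_base, split_p (split_s a) = a
}.

Record splitHom (X : skewBrace) (S T : splitExt X) : Type := SplitHom {
  split_f : skbHom (split_total S) (split_total T);
  split_g : skbHom (split_base S) (split_base T);
  split_fmu : forall x : X, split_f (split_mu S x) = split_mu T x;
  split_pf : forall e : split_total S,
    split_p T (split_f e) = split_g (split_p S e);
  split_fs : forall a : split_base S,
    split_f (split_s S a) = split_s T (split_g a)
}.

(* Morphisms are compared through their underlying maps, pointwise, so that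
   the proof components of the records are irrelevant. *)
Definition splitHom_eq (X : skewBrace) (S T : splitExt X)
    (m n : splitHom S T) : Prop :=
  split_f m =1 split_f n /\ split_g m =1 split_g n.

Definition split_faithful (X : skewBrace) (T : splitExt X) : Prop :=
  forall (S : splitExt X) (m n : splitHom S T), splitHom_eq m n.

Definition split_accessible (X : skewBrace) (S : splitExt X) : Prop :=
  exists T : splitExt X, split_faithful T /\ inhabited (splitHom S T).

Definition Skb_action_accessible : Prop :=
  forall (X : skewBrace) (S : splitExt X), split_accessible S.

(* Main.v *)
From mathcomp Require Import ssreflect ssrfun ssrbool.
Require Import Defs.

Set Implicit Arguments.
Unset Strict Implicit.
Unset Printing Implicit Defensive.

Local Open Scope skb_scope.

(** Let the group [(A, \oc)] act on [X] by skew brace automorphisms, and let [K]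
    be a sub skew brace of [A] acting trivially.  A morphism from the resulting
    split extension to a faithful one must kill [K]: otherwise [X * K] would
    have two distinct morphisms to the target, one of them forgetting [K].
    Hence it kills the ideal of [A] generated by [K], which must then act
    trivially on [X].  The action ignores [(A, +)], so this can be violated:
    take for [(A, +)] the dihedral group of order 8, as the semidirect product
    of [N = Z/2 * Z/2] by [H = Z/2] swapping the factors, and for [(A, \oc)] the
    direct product.  Then [K = H] is normal for [\oc] but not for [+], and
    its additive normal closure contains [(1, 1)] in [N].  Let the first factor
    of [N] act nontrivially on [X], and the other two factors trivially. *)

Lemma group_idem (T : Type) (op : T -> T -> T) (e : T) (inv : T -> T) (x : T) :
  is_group op e inv -> op x x = x -> x = e.
Proof. by case=> A l _ Vl _ xx; rewrite -[x]l -(Vl x) -A xx. Qed.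

Lemma skb_hom0 (B C : skewBrace) (f : skbHom B C) : f 0 = 0.
Proof.
apply: (group_idem (skb_add_group C)).
by rewrite -skb_homD (group1l (skb_add_group B)).
Qed.

Lemma skb_add0 (B : skewBrace) : left_id (0 : B) (@skb_add B).
Proof. exact: group1l (skb_add_group B). Qed.

Lemma skb_addr0 (B : skewBrace) : right_id (0 : B) (@skb_add B).
Proof. exact: group1r (skb_add_group B). Qed.

Lemma skb_circ0 (B : skewBrace) : left_id (0 : B) (@skb_circ B).
Proof. by rewrite -skb_one_zero; exact: group1l (skb_circ_group B). Qed.

Lemma skb_circr0 (B : skewBrace) : right_id (0 : B) (@skb_circ B).
Proof. by rewrite -skb_one_zero; exact: group1r (skb_circ_group B). Qed.

Definition skb_comp (B C D : skewBrace) (g : skbHom C D) (f : skbHom B C) :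
  skbHom B D.
Proof.
by exists (fun x => g (f x)) => x y; rewrite ?(skb_homD, skb_homC).
Defined.

Definition skb_null (B C : skewBrace) : skbHom B C.
Proof.
by exists (fun=> 0) => _ _; rewrite ?skb_add0 ?skb_circ0.
Defined.

Definition trivial_brace (T : Type) (op : T -> T -> T) (e : T) (inv : T -> T)
  (grp : is_group op e inv) : skewBrace.
Proof.
apply: (SkewBrace grp grp) => a b c; have [A l r Vl _] := grp.
by rewrite [in RHS]A -(A (op a b) (inv a)) Vl r A.
Defined.

(** * Split extensions from semidirect products *)

Section Semidirect.

Variables (X A : skewBrace) (act : A -> X -> X).
Hypothesis actD : forall a x y, act a (x + y) = act a x + act a y.
Hypothesis actC : forall a x y, act a (x \oc y) = act a x \oc act a y.
Hypothesis actM : forall a b x, act (a \oc b) x = act a (act b x).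
Hypothesis act1 : forall x, act 0 x = x.

Lemma act0 a : act a 0 = 0.
Proof. by apply: (group_idem (skb_add_group X)); rewrite -actD skb_add0. Qed.

Definition semidirect_add (u v : X * A) := (u.1 + v.1, u.2 + v.2).

Definition semidirect_circ (u v : X * A) :=
  (u.1 \oc act u.2 v.1, u.2 \oc v.2).

Lemma semidirect_add_group :
  is_group semidirect_add (0, 0) (fun u => (- u.1, - u.2)).
Proof.
have [xA xl xr xVl xVr] := skb_add_group X.
have [aA al ar aVl aVr] := skb_add_group A.
split=> [[x a] [y b] [z c]|[x a]|[x a]|[x a]|[x a]]; rewrite /semidirect_add /=.
- by rewrite xA aA.
- by rewrite xl al.
- by rewrite xr ar.
- by rewrite xVl aVl.
- by rewrite xVr aVr.
Qed.

Lemma semidirect_circ_group :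
  is_group semidirect_circ (0, 0)
    (fun u => (act (skb_inv u.2) (skb_inv u.1), skb_inv u.2)).
Proof.
have [xA xl xr xVl xVr] := skb_circ_group X.
have [aA al ar aVl aVr] := skb_circ_group A.
split=> [[x a] [y b] [z c]|[x a]|[x a]|[x a]|[x a]];
  rewrite /semidirect_circ /=.
- by rewrite actC actM xA aA.
- by rewrite act1 !skb_circ0.
- by rewrite act0 !skb_circr0.
- by rewrite -actC xVl aVl !skb_one_zero act0.
- by rewrite -actM aVr skb_one_zero act1 xVr skb_one_zero.
Qed.

(** The circle products in the brace identity are all twisted by the same [act a], with [a] the
    second component of the left factor, so additivity of [act a] reduces it to the identities of
    [X] and [A]. *)
Definition semidirect : skewBrace.
Proof.
apply: (SkewBrace semidirect_add_group semidirect_circ_group).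
move=> [x a] [y b] [z c]; rewrite /semidirect_circ /semidirect_add /=.
by rewrite actD !skb_brace.
Defined.

Definition semidirect_p : skbHom semidirect A.
Proof. by exists snd. Defined.

Definition semidirect_s : skbHom A semidirect.
Proof.
exists (fun a => (0, a)) => a b /=.
- by rewrite /semidirect_add /= skb_add0.
- by rewrite /semidirect_circ /= act0 skb_circ0.
Defined.

Definition semidirect_mu : skbHom X semidirect.
Proof.
exists (fun x => (x, 0)) => x y /=.
- by rewrite /semidirect_add /= skb_add0.
- by rewrite /semidirect_circ /= act1 skb_circ0.
Defined.

Definition semidirect_ext : splitExt X.
Proof.
apply: (@SplitExt X A semidirect semidirect_p semidirect_s semidirect_mu).
- by move=> x y [].
- move=> [x a] /=; split=> [->|[y [_ <-]] //].
  by exists x.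
- by [].
Defined.

End Semidirect.

(** * Morphisms into a faithful split extension *)

Section NotAccessible.

Variables (X A K : skewBrace) (act : A -> X -> X) (kappa : skbHom K A).
Hypothesis actD : forall a x y, act a (x + y) = act a x + act a y.
Hypothesis actC : forall a x y, act a (x \oc y) = act a x \oc act a y.
Hypothesis actM : forall a b x, act (a \oc b) x = act a (act b x).
Hypothesis act1 : forall x, act 0 x = x.
Hypothesis actK : forall k x, act (kappa k) x = x.

Let S := semidirect_ext actD actC actM act1.

Let SK : splitExt X :=
  @semidirect_ext X K (fun=> id) (fun _ _ _ => erefl) (fun _ _ _ => erefl)
    (fun _ _ _ => erefl) (fun=> erefl).

Definition incl_total : skbHom (split_total SK) (split_total S).
Proof.
exists (fun u : X * K => (u.1, kappa u.2)) => -[x k] [y l] /=.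
- by rewrite /semidirect_add /= skb_homD.
- by rewrite /semidirect_circ /= skb_homC actK.
Defined.

(** Compatible with [\oc] because [K] acts trivially in [SK], whose total object is thus a direct
    product. *)
Definition proj_kernel : skbHom (split_total SK) X.
Proof. by exists fst. Defined.

Variables (T : splitExt X) (m : splitHom S T).

Definition via_incl : splitHom SK T.
Proof.
apply: (@SplitHom X SK T (skb_comp (split_f m) incl_total)
  (skb_comp (split_g m) kappa)).
- by move=> x; rewrite /= skb_hom0; apply: (split_fmu m).
- by move=> [x k]; rewrite /= (split_pf m).
- by move=> k; apply: (split_fs m).
Defined.

Definition via_proj : splitHom SK T.
Proof.
apply: (@SplitHom X SK T (skb_comp (split_mu T) proj_kernel)
  (skb_null K (split_base T))).
- by [].
- by move=> [x k] /=; apply/split_mu_ker; exists x.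
- by move=> k /=; rewrite !skb_hom0.
Defined.

Lemma faithful_kills_trivial_action :
  split_faithful T -> forall k, split_g m (kappa k) = 0.
Proof. by move=> fT; have [_] := fT SK via_incl via_proj. Qed.

(** In the semidirect product, conjugating [x] by [a] for [\oc] gives [act a x]. Once [a] is sent to
    0, the images of [x] and [act a x] in [T] coincide, and the kernel [X] embeds in [T]. *)
Lemma killed_acts_trivially a : split_g m a = 0 -> forall x, act a x = x.
Proof.
move=> ga x; apply: (@split_mu_inj X T); rewrite -!(split_fmu m).
have fa : split_f m (split_s S a) = 0 by rewrite (split_fs m) ga skb_hom0.
have -> : split_f m (split_mu S (act a x))
          = split_f m (split_mu S (act a x) \oc split_s S a).
  by rewrite skb_homC fa skb_circr0.
have -> : split_mu S (act a x) \oc split_s S a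
          = split_s S a \oc split_mu S x.
  by rewrite /= /semidirect_circ /= !(skb_circ0, skb_circr0) act1 skb_circr0.
by rewrite skb_homC fa skb_circ0.
Qed.

End NotAccessible.

(** The condition quantified over [C] and [g] expresses, without ideals or quotients, that [a] lies
    in the ideal generated by the image of [kappa]. *)
Lemma semidirect_not_accessible (X A K : skewBrace) (act : A -> X -> X)
    (kappa : skbHom K A)
    (actD : forall a x y, act a (x + y) = act a x + act a y)
    (actC : forall a x y, act a (x \oc y) = act a x \oc act a y)
    (actM : forall a b x, act (a \oc b) x = act a (act b x))
    (act1 : forall x, act 0 x = x) (a : A) (x : X) :
  (forall k y, act (kappa k) y = y) ->
  (forall (C : skewBrace) (g : skbHom A C),
     (forall k, g (kappa k) = 0) -> g a = 0) ->
  act a x <> x ->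
  ~ split_accessible (semidirect_ext actD actC actM act1).
Proof.
move=> actK closK ax [T [fT [m]]]; apply: ax.
apply: (killed_acts_trivially (m := m)); apply: closK.
exact: faithful_kills_trivial_action.
Qed.

(** * The dihedral example *)

Definition swap_if (b : bool) (x : bool * bool) := if b then (x.2, x.1) else x.

Definition addb2 (x y : bool * bool) := (x.1 (+) y.1, x.2 (+) y.2).

Lemma addb_group : is_group addb false id.
Proof. by split; do ?case. Qed.

Lemma addb2_group : is_group addb2 (false, false) id.
Proof. by split; do ?[case=> [[] []]]. Qed.

Definition Z2_brace := trivial_brace addb_group.
Definition V4_brace := trivial_brace addb2_group.

Definition D8_add (u v : bool * bool * bool) :=
  (addb2 u.1 (swap_if u.2 v.1), u.2 (+) v.2).

Definition D8_circ (u v : bool * bool * bool) := (addb2 u.1 v.1, u.2 (+) v.2).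

Lemma D8_add_group :
  is_group D8_add (false, false, false) (fun u => (swap_if u.2 u.1, u.2)).
Proof. by split; do ?[case=> [[[] []] []]]. Qed.

Lemma D8_circ_group : is_group D8_circ (false, false, false) id.
Proof. by split; do ?[case=> [[[] []] []]]. Qed.

(** Conceptually, [- a + a \oc b] is the additive conjugate of [b] by the [H]-component of [a],
    hence additive in [b], which is the brace identity. *)
Definition D8_brace : skewBrace.
Proof.
apply: (SkewBrace D8_add_group D8_circ_group).
by do 3!case=> [[[] []] []].
Defined.

Definition D8_act (u : D8_brace) : V4_brace -> V4_brace := swap_if u.1.1.

Lemma D8_actD (u : D8_brace) (x y : V4_brace) :
  D8_act u (x + y) = D8_act u x + D8_act u y.
Proof. by move: u x y => [[[] b] h] [x1 x2] [y1 y2]. Qed.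

Lemma D8_actM (u v : D8_brace) (x : V4_brace) :
  D8_act (u \oc v) x = D8_act u (D8_act v x).
Proof. by move: u v x => [[[] b] h] [[[] b'] h'] [x1 x2]. Qed.

Definition D8_reflection : skbHom Z2_brace D8_brace.
Proof. by exists (fun h => (false, false, h)); do 2!case. Defined.

Theorem theorem2p13 :
  ~ Skb_action_accessible /\
  exists (X : skewBrace) (S : splitExt X), ~ split_accessible S.
Proof.
suff notacc : exists (X : skewBrace) (S : splitExt X), ~ split_accessible S.
  by split=> // acc; have [X [S]] := notacc; apply; apply: acc.
exists V4_brace.
(* The two laws of [V4_brace] coincide, so [D8_actD] covers both. *)
exists (semidirect_ext (act := D8_act) D8_actD D8_actD D8_actM (fun=> erefl)).
(* By computation [H] acts trivially and [a], whose first bit is set, moves [x]; only the ideal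
   condition remains. *)
apply: (semidirect_not_accessible (act := D8_act) (kappa := D8_reflection)
  (a := (true, true, false)) (x := (true, false))) => // C g gK.
pose c : D8_brace := (true, false, false).
pose k : D8_brace := (false, false, true).
(* [c] is an additive involution, so this is [c + k - c + k]. *)
have -> : (true, true, false) = c + k + c + k :> D8_brace by [].
rewrite !skb_homD (gK true) !skb_addr0 -skb_homD.
(* The remaining [c + c] computes to 0. *)
exact: skb_hom0.
Qed.
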